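(* Let $N_6$ be the linear network with parties $P,Q,R,S$ and channels $a$ (between $P$ and $Q$), $b$ (between $Q$ and $R$), and $c$ (between $R$ and $S$). For any protocol ${\cal P}$ over $N_6$: if $\{a,b\}$ functionally determines $\{c\}$ with respect to ${\cal P}$ and $a\parallel b$ holds with respect to ${\cal P}$, then $\{b\}$ functionally determines $\{c\}$ with respect to ${\cal P}$.
   Context: A semi-protocol over a network (a finite graph whose vertices are parties and edges are channels) assigns to each channel $x$ a set $V(x)$ of values and to each party $p$ a predicate $L_p$ on the values of the channels incident with $p$; a run is a function $r$ with $r(x)\in V(x)$ for every channel $x$ such that every $L_p$ holds of the values of the channels incident with $p$; a protocol is a semi-protocol with at least one run, and ${\cal R}({\cal P})$ is its set of runs. A set of channels $A$ functionally determines a set $B$ w.r.t. ${\cal P}$ if any two runs agreeing on all channels of $A$ agree on all channels of $B$. For channels $a,b$, $a\parallel b$ (independence) w.r.t. ${\cal P}$ means that for any runs $r_1,r_2\in{\cal R}({\cal P})$ there is a run $r_3\in{\cal R}({\cal P})$ with $r_3(a)=r_1(a)$ and $r_3(b)=r_2(b)$. *)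

(* Defs.v *)
From HB Require Import structures.
From mathcomp Require Import all_boot.

Set Implicit Arguments.
Unset Strict Implicit.
Unset Printing Implicit Defensive.

(* A finite undirected graph. Channels have their own identity, so parallel
   edges are allowed; a one-element set of ends is a loop. *)
Record network := Network {
  party : finType;
  channel : finType;
  ends : channel -> {set party};
  ends_card : forall x, 0 < #|ends x| <= 2
}.

Definition incident_channel (N : network) (p : party N) : Type :=
  {x : channel N | p \in ends x}.

Record semi_protocol (N : network) := SemiProtocol {
  values : channel N -> Type;
  (* L_p only sees the values of the channels incident with p. *)
  local_condition : forall p : party N,
    (forall x : incident_channel p, values (sval x)) -> Prop
}.

Definition assignment (N : network) (P : semi_protocol N) : Type :=
  forall x : channel N, values P x.

Definition is_run (N : network) (P : semi_protocol N) (r : assignment P) : Prop :=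
  forall p : party N,
    local_condition (fun x : incident_channel p => r (sval x)).

Record protocol (N : network) := Protocol {
  protocol_semi :> semi_protocol N;
  protocol_run : exists r : assignment protocol_semi, is_run r
}.

Definition agree_on (N : network) (P : semi_protocol N)
    (A : {set channel N}) (r1 r2 : assignment P) : Prop :=
  forall x : channel N, x \in A -> r1 x = r2 x.

Definition functionally_determines (N : network) (P : protocol N)
    (A B : {set channel N}) : Prop :=
  forall r1 r2 : assignment P, is_run r1 -> is_run r2 ->
    agree_on A r1 r2 -> agree_on B r1 r2.

Definition independent (N : network) (P : protocol N)
    (a b : channel N) : Prop :=
  forall r1 r2 : assignment P, is_run r1 -> is_run r2 ->
    exists r3 : assignment P, [/\ is_run r3, r3 a = r1 a & r3 b = r2 b].

Inductive N6_party := party_P | party_Q | party_R | party_S.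

Inductive N6_channel := chan_a | chan_b | chan_c.

Definition N6_party_code (p : N6_party) : 'I_4 :=
  match p with
  | party_P => inord 0 | party_Q => inord 1
  | party_R => inord 2 | party_S => inord 3
  end.

Definition N6_party_decode (i : 'I_4) : N6_party :=
  nth party_P [:: party_P; party_Q; party_R; party_S] i.

Lemma N6_party_codeK : cancel N6_party_code N6_party_decode.
Proof. by case; rewrite /N6_party_decode /= inordK. Qed.

HB.instance Definition _ := Finite.copy N6_party (can_type N6_party_codeK).

Definition N6_channel_code (x : N6_channel) : 'I_3 :=
  match x with
  | chan_a => inord 0 | chan_b => inord 1 | chan_c => inord 2
  end.

Definition N6_channel_decode (i : 'I_3) : N6_channel :=
  nth chan_a [:: chan_a; chan_b; chan_c] i.

Lemma N6_channel_codeK : cancel N6_channel_code N6_channel_decode.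
Proof. by case; rewrite /N6_channel_decode /= inordK. Qed.

HB.instance Definition _ := Finite.copy N6_channel (can_type N6_channel_codeK).

Definition N6_ends (x : N6_channel) : {set N6_party} :=
  match x with
  | chan_a => [set party_P; party_Q]
  | chan_b => [set party_Q; party_R]
  | chan_c => [set party_R; party_S]
  end.

Lemma N6_ends_card x : 0 < #|N6_ends x| <= 2.
Proof. by case: x; rewrite cards2; case: (_ != _). Qed.

(* The path  P --a-- Q --b-- R --c-- S. *)
Definition N6 : network := Network N6_ends_card.

Definition N6_a : channel N6 := chan_a.
Definition N6_b : channel N6 := chan_b.
Definition N6_c : channel N6 := chan_c.

(* Main.v *)
(* The runs r1 and r2 agree on b, so r1 on {a, b} glued with r2 on {c} is again
   a run: P and Q see only values of r1, while R and S see only values of r2.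
   It agrees with r1 on {a, b} and with r2 on c, hence r1 and r2 agree on c. *)
Require Import Defs.
From mathcomp Require Import all_boot.
From Stdlib Require Import FunctionalExtensionality.

(** The condition at [p] cannot tell [s] from the run chosen for [p], and that run may vary with the
    party. *)
Lemma is_run_locally (N : network) (P : semi_protocol N) (s : assignment P) :
  (forall p : party N, exists2 r : assignment P, is_run r &
     forall x : channel N, p \in ends x -> s x = r x) ->
  is_run s.
Proof.
move=> loc p; have [r run_r eq_sr] := loc p.
(* [local_condition] takes a function, so pointwise agreement must become equality, by
   extensionality. *)
suff -> : (fun x : incident_channel p => s (sval x)) = (fun x => r (sval x)).
  exact: run_r.
by apply: functional_extensionality_dep => -[x px]; exact: eq_sr.
Qed.

Definition N6_splice (P : semi_protocol N6) (r1 r2 : assignment P) :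
    assignment P :=
  fun x => match x with
  | chan_a => r1 chan_a
  | chan_b => r1 chan_b
  | chan_c => r2 chan_c
  end.

Lemma N6_splice_run (P : semi_protocol N6) (r1 r2 : assignment P) :
  is_run r1 -> is_run r2 -> r1 N6_b = r2 N6_b -> is_run (N6_splice P r1 r2).
Proof.
move=> run1 run2 eq_b; apply: is_run_locally => -[].
- by exists r1 => // -[] //=; case/set2P.
- by exists r1 => // -[] //=; case/set2P.
(* Only [party_R] sees both [chan_b] and [chan_c]; [eq_b] turns the value of [r1] on [chan_b] into
   that of [r2]. *)
- by exists r2 => // -[] //=; case/set2P.
- by exists r2 => // -[] //=; case/set2P.
Qed.

Theorem theorem10 (P : protocol N6) :
  functionally_determines P [set N6_a; N6_b] [set N6_c] ->
  independent P N6_a N6_b ->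
  functionally_determines P [set N6_b] [set N6_c].
Proof.
move=> det_ab _ r1 r2 run1 run2 agree_b.
have eq_b : r1 N6_b = r2 N6_b by apply: agree_b; rewrite inE.
have agree_ab : agree_on [set N6_a; N6_b] r1 (N6_splice P r1 r2).
  by case=> //= /set2P[].
have agree_c := det_ab _ _ run1 (N6_splice_run P r1 r2 run1 run2 eq_b) agree_ab.
(* Once [x] is [N6_c], the splice computes to [r2]. *)
by move=> x xc; rewrite (agree_c x xc); move/set1P: xc => ->.
Qed.
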